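(* Let $\mathbb{K}\in\{\mathbb{R},\mathbb{C}\}$, let $(X,\langle\cdot|\cdot\rangle)$ be a non-trivial $\mathbb{K}$-Hilbert space, let $A$ be a densely-defined, linear and self-adjoint operator in $X$ with a purely discrete spectrum $\sigma(A)$, let $M\subset X$ be a Hilbert basis consisting of eigenvectors of $A$, and let $*$ be the convolution associated to $M$. Then, for every $\xi\in X$ satisfying $$\langle e|\xi\rangle=\langle e'|\xi\rangle$$ for all $e,e'\in M$ corresponding to the same eigenvalue of $A$, the operator $\xi*\cdot$ is a bounded function of $A$; that is, there is a bounded function $f$ on $\sigma(A)$ such that $\xi*\cdot=f(A)$.
   Context: The inner product is conjugate-linear in the first and linear in the second argument. A Hilbert basis is a complete orthonormal system. ''Purely discrete spectrum'' means that $\sigma(A)$ consists of isolated points which are eigenvalues of finite multiplicity. For $e\in M$ let $\lambda(e)\in\mathbb{R}$ be the corresponding eigenvalue, so $\sigma(A)=\{\lambda(e):e\in M\}$; for a bounded ($\mathbb{K}$-valued) function $f$ on $\sigma(A)$, $f(A)$ is the operator given by the functional calculus, i.e. the bounded linear operator on $X$ determined by $f(A)e=f(\lambda(e))e$ for all $e\in M$. The convolution associated to $M$ is $$\xi*\eta:=\sum_{e\in M(\xi)\cap M(\eta)}\langle e|\xi\rangle\langle e|\eta\rangle\, e ,\qquad M(\xi):=\{e\in M:\langle e|\xi\rangle\neq0\}.$$ *)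

(* Defs.v *)
From HB Require Import structures.
From mathcomp Require Import all_boot all_order all_algebra.
From mathcomp Require Import sesquilinear complex.
From mathcomp Require Import all_classical all_reals all_analysis.
From mathcomp Require Import summability.

Set Implicit Arguments.
Unset Strict Implicit.
Unset Printing Implicit Defensive.

Import Order.TTheory GRing.Theory Num.Theory.
Import numFieldNormedType.Exports.

Local Open Scope classical_set_scope.
Local Open Scope ring_scope.

Inductive scalar_kind := RealScalars | ComplexScalars.

Definition scalarField (R : realType) (k : scalar_kind) : numFieldType :=
  match k with
  | RealScalars => R
  | ComplexScalars => R[i]
  end.

Definition conjK (R : realType) (k : scalar_kind) :
    {rmorphism scalarField R k -> scalarField R k} :=
  match k return {rmorphism scalarField R k -> scalarField R k} with
  | RealScalars => idfun
  | ComplexScalars => conjc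
  end.

(* As always over a numFieldType, norms take their values in the scalar field
   itself (in the nonnegative real scalars). *)
HB.mixin Record CompleteNormedModule_isHilbert
    (R : realType) (k : scalar_kind) X
    of CompleteNormedModule (scalarField R k) X := {
  dotf : {dot X for conjK R k};
  dotf_norm : forall x : X, dotf x x = `|x| ^+ 2
}.

#[short(type="hilbertType")]
HB.structure Definition Hilbert (R : realType) (k : scalar_kind) :=
  {X of CompleteNormedModule (scalarField R k) X
      & CompleteNormedModule_isHilbert R k X}.

(* {dot _ for _} is linear on the left and conjugate-linear on the right; inner
   swaps the arguments, hence is conjugate-linear on the left and linear on the
   right. *)
Definition inner (R : realType) (k : scalar_kind) (X : hilbertType R k)
  (x y : X) : scalarField R k := dotf y x.

(* Only the values of op_fun on op_dom are meaningful. *)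
Record operator (K : numFieldType) (X : lmodType K) := Operator {
  op_dom : set X;
  op_fun :> X -> X;
  op_dom0 : op_dom 0;
  op_domP : forall (a : K) (x y : X),
    op_dom x -> op_dom y -> op_dom (a *: x + y);
  op_linear : forall (a : K) (x y : X),
    op_dom x -> op_dom y -> op_fun (a *: x + y) = a *: op_fun x + op_fun y
}.

Section Definitions.
Context (R : realType) (k : scalar_kind) (X : hilbertType R k).
Local Notation K := (scalarField R k).
Implicit Types (A : operator X) (M : set X).

Definition densely_defined A := dense (op_dom A).

Definition op_graph A : set (X * X) :=
  [set p | op_dom A p.1 /\ p.2 = A p.1].

Definition adjoint_graph A : set (X * X) :=
  [set p | forall x, op_dom A x -> inner p.1 (A x) = inner p.2 x].

Definition self_adjoint A := adjoint_graph A = op_graph A.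

Definition bounded_linear (T : X -> X) :=
  linear T /\ exists C : K, forall x, `|T x| <= C * `|x|.

Definition resolvent_set A : set K :=
  [set l | exists B : X -> X, [/\ bounded_linear B,
     forall y, op_dom A (B y) /\ A (B y) - l *: B y = y &
     forall x, op_dom A x -> B (A x - l *: x) = x]].

Definition spectrum A : set K := ~` resolvent_set A.

Definition eigenspace A (l : K) : set X :=
  [set x | op_dom A x /\ A x = l *: x].

Definition eigenvector A (l : K) (x : X) := x != 0 /\ eigenspace A l x.

Definition finite_dim (E : set X) := exists (n : nat) (b : 'I_n -> X),
  E = [set x | exists c : 'I_n -> K, x = \sum_(i < n) c i *: b i].

Definition purely_discrete_spectrum A := forall l, spectrum A l ->
  [/\ isolated (spectrum A) l,
      exists x, eigenvector A l x &
      finite_dim (eigenspace A l)].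

Definition hilbert_basis M :=
  (forall e e', M e -> M e' -> inner e e' = (e == e')%:R) /\
  (forall x, (forall e, M e -> inner e x = 0) -> x = 0).

Definition basis_support M (x : X) : set X :=
  [set e | M e /\ inner e x != 0].

(* [sum] is the limit of the finite partial sums along the directed set of
   finite subsets of the index type; for a Hilbert basis M it always exists. *)
Definition basis_conv M (x y : X) : X :=
  sum (fun e : X =>
    if e \in basis_support M x `&` basis_support M y
    then (inner e x * inner e y) *: e else 0).

(* T = f(A). For a Hilbert basis M of eigenvectors and f bounded on the
   spectrum, exactly one T satisfies this; only f on the spectrum matters. *)
Definition is_function_of A M (f : K -> K) (T : X -> X) :=
  bounded_linear T /\
  forall e l, M e -> eigenvector A l e -> T e = f l *: e.

End Definitions.

(* Main.v *)
(** With respect to [M], the convolution by [xi] is the diagonal operator with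
    entries [<e|xi>], which are bounded by [|xi|]. A bounded diagonal operator is
    well defined and bounded: Bessel's inequality makes the finite partial sums
    Cauchy. By the compatibility hypothesis the entry at [e] depends only on the
    eigenvalue of [e], and this dependence is [f], extended by [0]. *)
Require Import Defs.
From HB Require Import structures.
From mathcomp Require Import all_boot all_order all_algebra.
From mathcomp Require Import sesquilinear complex.
From mathcomp Require Import all_classical all_reals all_analysis.
From mathcomp Require Import finmap summability.

Import Order.TTheory GRing.Theory Num.Theory.
Import numFieldNormedType.Exports.

Local Open Scope classical_set_scope.
Local Open Scope ring_scope.

(* The library declares this instance inside a section, so it is not exported. *)
#[local] Existing Instance totally_filter.

Lemma conjK_normE (R : realType) (k : scalar_kind) (a : scalarField R k) :
  a * conjK R k a = `|a| ^+ 2.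
Proof.
case: k a => [a|a] /=; first by rewrite real_normK ?num_real// expr2.
by rewrite sqr_normc.
Qed.

(** The archimedean property descends to [R]: in the complex case [0 <= a] forces the imaginary part
    to vanish. *)
Lemma scalarField_lt_nat (R : realType) (k : scalar_kind) (a : scalarField R k) :
  0 <= a -> exists n, a < n%:R.
Proof.
case: k a => [a|[a b]] /= a0.
  by exists (Num.bound a); exact: archi_boundP.
move: a0; rewrite lecE/= => /andP[/eqP b0 a0].
exists (Num.bound a).
by rewrite -(rmorph_nat (real_complex R)) ltcE /= b0 eqxx archi_boundP.
Qed.

Lemma sum_fsetD (I : choiceType) (V : nmodType) (F : I -> V) (J B : {fset I}) :
  (J `<=` B)%fset ->
  \sum_(i <- B) F i = \sum_(i <- J) F i + \sum_(i <- (B `\` J)%fset) F i.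
Proof.
move=> JB; rewrite (big_fsetID _ (mem J)) /=; congr (_ + _).
  congr bigop; congr enum_fset; apply/fsetP => i; rewrite !inE/= andbC.
  by case: (boolP (i \in J)) => // /(fsubsetP JB).
by congr bigop; congr enum_fset; apply/fsetP => i; rewrite !inE/= andbC.
Qed.

(* Otherwise disjoint blocks of mass at least [eps] could be stacked
   indefinitely, contradicting the bound [C]. *)
Lemma bounded_sum_tail (R : realType) (k : scalar_kind) (I : choiceType)
    (a : I -> scalarField R k) (C eps : scalarField R k) :
  (forall i, 0 <= a i) -> (forall J : {fset I}, \sum_(i <- J) a i <= C) ->
  0 < eps ->
  exists J : {fset I}, forall B : {fset I}, (J `<=` B)%fset ->
    \sum_(i <- (B `\` J)%fset) a i < eps.
Proof.
move=> a0 aC eps0; apply: contrapT => /forallNP noJ.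
have stack n : exists J : {fset I}, eps *+ n <= \sum_(i <- J) a i.
  elim: n => [|n [J Jn]]; first by exists fset0; rewrite mulr0n big_seq_fset0.
  have /existsNP[B /not_implyP[JB /negP]] := noJ J.
  rewrite -real_leNgt ?realE ?(ltW eps0) ?sumr_ge0// => epsB.
  by exists B; rewrite (sum_fsetD _ _ _ _ _ JB) mulrSr lerD.
have C0 : 0 <= C by have := aC fset0; rewrite big_seq_fset0.
have [n] := scalarField_lt_nat _ _ _ (divr_ge0 C0 (ltW eps0)).
rewrite ltr_pdivrMr// mulr_natl => Cn.
have [J Jn] := stack n.
by have := lt_le_trans Cn (le_trans Jn (aC J)); rewrite ltxx.
Qed.

Section Convolution.
Context (R : realType) (k : scalar_kind) (X : hilbertType R k) (M : set X).
Local Notation K := (scalarField R k).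
Context (M_basis : hilbert_basis M).

(** Extending the coefficients by 0 off [M] lets all sums be indexed by the whole type [X], so that
    finite sets of arbitrary vectors are allowed. *)
Definition coef (x e : X) : K := if e \in M then inner e x else 0.

Lemma coef_linear (a : K) (x y e : X) :
  coef (a *: x + y) e = a * coef x e + coef y e.
Proof.
rewrite /coef /inner; case: ifP => _; last by rewrite mulr0 addr0.
by rewrite linearPl.
Qed.

Lemma coef_basis (e e' : X) : M e -> coef e e' = (e' == e)%:R.
Proof.
move=> Me; rewrite /coef; case: ifPn => e'M.
  by rewrite M_basis.1//; exact: set_mem e'M.
by case: eqP e'M => // ->; rewrite mem_set.
Qed.

(** Pythagoras: terms off [M] vanish, and orthonormality kills the mixed products of the others. *)
Lemma norm_sum_basis (r : seq X) (c : X -> K) :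
  uniq r -> (forall e, ~ M e -> c e = 0) ->
  `|\sum_(e <- r) c e *: e| ^+ 2 = \sum_(e <- r) `|c e| ^+ 2.
Proof.
move=> ur cM; rewrite -dotf_norm linear_sumlz; apply: eq_big_seq => e er.
have [Me|/cM->] := pselect (M e); last first.
  by rewrite scale0r linear0l normr0 expr0n.
rewrite linearZl_LR -conjK_normE /=; congr (_ * _).
rewrite linear_sumr (bigD1_seq e)//= big1 ?addr0 => [|e' e'e].
  by rewrite linearZr_LR/= [dotf _ _](M_basis.1 _ _ Me Me) eqxx mulr1.
have [Me'|/cM->] := pselect (M e'); last by rewrite scale0r linear0r.
by rewrite linearZr_LR/= [dotf _ _](M_basis.1 _ _ Me' Me) (negbTE e'e) mulr0.
Qed.

Lemma bessel (r : seq X) (x : X) :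
  uniq r -> \sum_(e <- r) `|coef x e| ^+ 2 <= `|x| ^+ 2.
Proof.
move=> ur; have cM e : ~ M e -> coef x e = 0.
  by move=> Me; rewrite /coef memNset.
rewrite -norm_sum_basis//; set p := \sum_(e <- r) _.
(* [p] is the orthogonal projection of [x] onto the span of the basis vectors in [r], so [x - p] is
   orthogonal to [p] and Pythagoras applies to [x = (x - p) + p]. *)
have px : dotf (x - p) p = 0.
  have pp : dotf p p = \sum_(e <- r) `|coef x e| ^+ 2.
    by rewrite dotf_norm norm_sum_basis.
  transitivity (dotf x p - dotf p p); first exact: linearBl.
  rewrite pp /p linear_sumr -sumrB.
  apply: big1 => e _; have [Me|/cM->] := pselect (M e); last first.
    by rewrite scale0r linear0r normr0 expr0n subr0.
  by rewrite linearZr_LR/= -conjK_normE /coef mem_set// /inner mulrC subrr.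
have := hnormDd px; rewrite subrK => dotfD.
have -> : `|x| ^+ 2 = `|x - p| ^+ 2 + `|p| ^+ 2 by rewrite -!dotf_norm.
by rewrite lerDr exprn_ge0.
Qed.

Lemma coef_le_norm (x e : X) : `|coef x e| <= `|x|.
Proof.
have := bessel [:: e] x isT; rewrite big_seq1.
by rewrite ler_pXn2r// nnegrE.
Qed.

Section Multiplier.
Context (c : X -> K) (C : K) (c_le : forall e, `|c e| <= C).

Local Notation partial x := (partial_sum (fun e => (c e * coef x e) *: e)).

Lemma multiplier_bound_ge0 : 0 <= C. Proof. exact: le_trans (c_le 0). Qed.

Lemma partial_sumE (x : X) (J : {fset X}) :
  partial x J = \sum_(e <- J) (c e * coef x e) *: e.
Proof. by rewrite big_seq_fsetE. Qed.

Lemma norm_multiplier_sum (x : X) (r : seq X) : uniq r ->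
  `|\sum_(e <- r) (c e * coef x e) *: e| ^+ 2
    <= C ^+ 2 * \sum_(e <- r) `|coef x e| ^+ 2.
Proof.
move=> ur; rewrite norm_sum_basis// => [|e Me]; last first.
  by rewrite /coef memNset// mulr0.
rewrite mulr_sumr; apply: ler_sum => e _.
rewrite normrM exprMn ler_wpM2r ?exprn_ge0//.
by rewrite lerXn2r ?nnegrE ?multiplier_bound_ge0.
Qed.

Lemma norm_partial_sum (x : X) (J : {fset X}) : `|partial x J| <= C * `|x|.
Proof.
rewrite -(@ler_pXn2r _ 2) ?nnegrE ?mulr_ge0 ?multiplier_bound_ge0//.
rewrite partial_sumE exprMn.
apply: le_trans (norm_multiplier_sum _ _ (fset_uniq J)) _.
by rewrite ler_wpM2l ?exprn_ge0 ?multiplier_bound_ge0 ?bessel ?fset_uniq.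
Qed.

Lemma cvg_multiplier (x : X) : cvg (partial x @ totally).
Proof.
apply: cauchy_cvg; apply: cauchy_exP => eps eps0.
(* Chosen so that [(C + 1) ^+ 2 * d = eps ^+ 2]; dividing by [C + 1] covers the case [C = 0]. *)
pose d := (eps / (C + 1)) ^+ 2.
have C1 : 0 < C + 1 by rewrite ltr_wpDl ?multiplier_bound_ge0.
have [|||J HJ] :=
  @bounded_sum_tail _ _ _ (fun e => `|coef x e| ^+ 2) (`|x| ^+ 2) d.
- by move=> e; rewrite exprn_ge0.
- by move=> J; rewrite bessel ?fset_uniq.
- by rewrite exprn_gt0 ?divr_gt0.
(* For [B] containing [J], the two partial sums differ by the sum over the difference set, whose
   coefficients have square mass below [d]. *)
exists (partial x J); exists J => // B /= JB.
rewrite -ball_normE /= !partial_sumE (sum_fsetD _ _ _ _ _ JB).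
rewrite opprD addrA subrr add0r normrN.
rewrite -(@ltr_pXn2r _ 2) ?nnegrE ?(ltW eps0)//.
apply: le_lt_trans (norm_multiplier_sum _ _ (fset_uniq _)) _.
apply: (@le_lt_trans _ _
  ((C + 1) ^+ 2 * \sum_(e <- (B `\` J)%fset) `|coef x e| ^+ 2)).
  apply: ler_wpM2r; first by rewrite sumr_ge0// => e _; rewrite exprn_ge0.
  by rewrite lerXn2r ?nnegrE ?multiplier_bound_ge0 ?(ltW C1)// lerDl.
have := HJ _ JB; rewrite -(ltr_pM2l (exprn_gt0 2 C1)) /d.
by rewrite -exprMn [(C + 1) * (_ / _)]mulrC divfK// gt_eqF.
Qed.

Definition multiplier (x : X) : X := sum (fun e => (c e * coef x e) *: e).

Lemma multiplier_bounded_linear : bounded_linear multiplier.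
Proof.
split=> [a x y|].
  apply: cvg_lim; first exact: norm_hausdorff.
  have -> : partial (a *: x + y) = (a \*: partial x) + partial y.
    apply/funext => J; rewrite fctE/= !partial_sumE scaler_sumr -big_split/=.
    apply: eq_bigr => e _.
    by rewrite coef_linear mulrDr scalerDl scalerA mulrCA.
  by apply: cvgD; [apply: cvgZr|]; exact: cvg_multiplier.
(* The uniform bound on partial sums passes to the limit: some partial sum is within [eps] of it. *)
exists C => x; apply/ler_addgt0Pr => eps eps0.
have /cvgrPdist_lt/(_ _ eps0) := cvg_multiplier x.
case=> J _ /(_ J (fsubset_refl _)) /= /ltW Jeps.
rewrite -[multiplier x](subrK (partial x J)) addrC.
by apply: le_trans (ler_normD _ _) (lerD (norm_partial_sum _ _) Jeps).
Qed.

Lemma multiplier_basis (e : X) : M e -> multiplier e = c e *: e.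
Proof.
move=> Me; apply: cvg_lim; first exact: norm_hausdorff.
(* Only the term at [e] survives, so the partial sums are constant once [J] contains [e]. *)
apply: cvg_near_cst; exists [fset e]%fset => // J /=.
rewrite fsub1set => eJ.
rewrite partial_sumE (bigD1_seq e)//= ?fset_uniq// coef_basis// eqxx mulr1.
rewrite big1 ?addr0// => e' /negbTE e'e.
by rewrite coef_basis// e'e mulr0 scale0r.
Qed.

End Multiplier.

(** Restricting the convolution to the common support only drops terms with a zero coefficient. *)
Lemma basis_convE (x : X) : basis_conv M x = multiplier (coef x).
Proof.
apply/funext => y; rewrite /basis_conv /multiplier; congr sum.
apply/funext => e; rewrite /coef; case: ifPn => [/set_mem[[Me _] _]|].
  by rewrite mem_set.
case: (boolP (e \in M)) => [/set_mem Me|]; last by rewrite mulr0 scale0r.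
case: (eqVneq (inner e x) 0) => [->|ex]; first by rewrite mul0r scale0r.
case: (eqVneq (inner e y) 0) => [->|ey]; first by rewrite mulr0 scale0r.
by case/negP; exact/mem_set.
Qed.

End Convolution.

Theorem corollary4 (R : realType) (k : scalar_kind) (X : hilbertType R k)
    (A : operator X) (M : set X) (xi : X)
    (X_nontrivial : exists x : X, x != 0)
    (A_dense : densely_defined A)
    (A_selfadj : self_adjoint A)
    (A_discrete : purely_discrete_spectrum A)
    (M_basis : hilbert_basis M)
    (M_eigen : forall e, M e -> exists l, eigenvector A l e)
    (xi_compat : forall (e e' : X) (l : scalarField R k), M e -> M e' ->
       eigenvector A l e -> eigenvector A l e' -> inner e xi = inner e' xi) :
  exists f : scalarField R k -> scalarField R k,
    [bounded f l | l in spectrum A] /\ is_function_of A M f (basis_conv M xi).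
Proof.
(* [xget] picks some basis vector with eigenvalue [l], or the default 0 if there is none. As [f l]
   is a coefficient of [xi] in either case, [|xi|] bounds it for every [l]. *)
pose f l := coef R k X M xi (xget 0 [set e | M e /\ eigenvector A l e]).
exists f; split.
  exists `|xi|; split; first exact: normr_real.
  move=> b /ltW xib l _; apply: le_trans xib.
  exact: coef_le_norm.
rewrite basis_convE; split.
  by apply: (multiplier_bounded_linear _ _ _ _ M_basis _ `|xi|);
    exact: coef_le_norm.
move=> e l Me le; rewrite multiplier_basis//; congr (_ *: _).
(* The chosen [e'] may differ from [e], but they share the eigenvalue [l], so [xi_compat] identifies
   their coefficients. The default case cannot occur, since [e] itself qualifies. *)
rewrite /f; case: xgetP => [e' _ [Me' le']|/(_ e)]; last by case.
by rewrite /coef !mem_set//; exact: xi_compat le le'.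
Qed.
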